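(* Let $\psi_a=\mu(\phi_p,\delta_q)y$, $\mu\in R[\xi_p,\xi_q]$, be a non-degenerate $\{\delta_p,\delta_q\}$-character of $\mathbb{G}_a$ over $R$, with groups of solutions $\mathcal U_0,\mathcal U_{\pm1},\mathcal U_{\pm},\mathcal U_{\rightarrow},\mathcal U_{\leftarrow}$, set $\mathcal K$ of characteristic integers, $\mathcal K_{\pm}$ the subsets of positive (resp. negative) elements of $\mathcal K$, and basic series $u_{a,\kappa,\alpha}$. Then: 1) If $\mathcal K=\emptyset$, then $\mathcal U_{\leftarrow}=\mathcal U_{\rightarrow}=\mathcal U_0$. 2) $\mathcal U_{\pm 1}=\bigoplus_{\kappa\in\mathcal K_{\pm}}\{u_{a,\kappa,\alpha} : \alpha\in R\}$ (internal direct sum). In particular, $\mathcal U_{\pm1}$ are free $R$-modules under convolution, with bases $\{u_{a,\kappa,1}:\kappa\in\mathcal K_{\pm}\}$, respectively. 3) $\mathcal U_{\rightarrow}+\mathcal U_{\leftarrow}=\mathcal U_{+}+\mathcal U_{-}$ (sums taken inside the additive group of formal series $\sum_{n\in\mathbb Z}a_nq^n$, $a_n\in R$).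
   Context: $p\ne 2$ is a prime, $R$ is the completion of the maximal unramified extension of $\mathbb Z_p$, $\phi:R\to R$ the unique automorphism lifting the $p$-power Frobenius on $k=R/pR$, $\mu(R)$ the group of roots of unity of $R$. $R((q))\hat{\ }=\{\sum_{n\in\mathbb Z}a_nq^n: a_n\in R,\ a_n\to0 \text{ as } n\to-\infty\}$ ($p$-adic limit) and $R((q^{-1}))\hat{\ }=\{\sum_{n\in\mathbb Z} a_nq^n:a_n\to0\text{ as }n\to\infty\}$. On these, $\phi_p(\sum a_nq^n)=\sum\phi(a_n)q^{pn}$ and $\delta_q(\sum a_nq^n)=\sum na_nq^n$. For $\mu(\xi_p,\xi_q)=\sum\mu_{ij}\xi_p^i\xi_q^j\in R[\xi_p,\xi_q]$, the character $\psi_a=\mu(\phi_p,\delta_q)y$ acts by $\psi_a u=\sum\mu_{ij}\phi_p^i\delta_q^ju$. It is non-degenerate if $\mu(0,0)\in R^\times$. A characteristic integer is $\kappa\in\mathbb Z$ with $\mu(0,\kappa)=0$ (such $\kappa$ is then prime to $p$). Groups of solutions of $\psi_a u=0$: $\mathcal U_0$ for $u\in R$; $\mathcal U_{1}$ for $u\in qR[[q]]$; $\mathcal U_{-1}$ for $u\in q^{-1}R[[q^{-1}]]$; $\mathcal U_+$ for $u\in R[[q]]$; $\mathcal U_-$ for $u\in R[[q^{-1}]]$; $\mathcal U_\rightarrow$ for $u\in R((q))\hat{\ }$; $\mathcal U_\leftarrow$ for $u\in R((q^{-1}))\hat{\ }$. Basic series: for $0\ne\kappa\in\mathbb Z$,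 $\alpha\in R$, $u_{a,\kappa,\alpha}=\sum_{n\ge0}b_{n,\kappa}\,\phi^n(\alpha)\,q^{\kappa p^n}$, where $b_{0,\kappa}=1$ and, for $n\ge1$, $$b_{n,\kappa}=-\frac{\sum_{s=1}^n\big(\sum_{j\ge0}\mu_{sj}\kappa^jp^{j(n-s)}\big)\phi^s(b_{n-s,\kappa})}{\sum_{j\ge0}\mu_{0j}\kappa^jp^{jn}}\in R.$$ Convolution: the $p$-adic completion $\mathbb Z\mu(R)\hat{\ }$ of the group ring of $\mu(R)$ acts on $q^{\pm1}R[[q^{\pm1}]]$ by $(f\star u)(q)=\sum_\zeta f(\zeta)u(\zeta q)$. For $\kappa$ prime to $p$, on $\{u_{a,\kappa,\alpha}:\alpha\in R\}$ this action factors through the surjective ring homomorphism $\mathbb Z\mu(R)\hat{\ }\to R$, $f\mapsto\sum_\zeta f(\zeta)\zeta^\kappa$, giving an $R$-module structure $\star$, explicitly $\beta\star u_{a,\kappa,\alpha}=u_{a,\kappa,\beta\alpha}$. The $R$-module structure on $\mathcal U_{\pm1}$ is the direct sum of these over $\kappa\in\mathcal K_\pm$. *)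

(* Defs.v *)
From mathcomp Require Import all_boot all_order all_algebra.
From mathcomp Require Import finmap.
From mathcomp Require Import mathcomp_extra boolp classical_sets functions.
From mathcomp Require Import cardinality fsbigop.

Set Implicit Arguments.
Unset Strict Implicit.
Unset Printing Implicit Defensive.

Import Order.TTheory GRing.Theory Num.Theory.
Local Open Scope classical_set_scope.
Local Open Scope ring_scope.

Section GroundRing.
Variables (p : nat) (R : idomainType).

(* x is divisible by p ^ N *)
Definition pdvd (N : nat) (x : R) : Prop := exists c : R, x = p%:R ^+ N * c.

Definition padic_cvg (x : nat -> R) (l : R) : Prop :=
  forall N, exists M, forall n, (M <= n)%N -> pdvd N (x n - l).

Definition padic_cauchy (x : nat -> R) : Prop :=
  forall N, exists M, forall m n, (M <= m)%N -> (M <= n)%N -> pdvd N (x m - x n).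

(* The completion of the maximal unramified extension of Z_p is, up to unique
   isomorphism, the complete discrete valuation ring of characteristic 0 with
   maximal ideal generated by p and whose residue field k is an algebraic
   closure of F_p (it is the ring of Witt vectors of k).  Here [pi] is the
   reduction R -> k = R / p R. *)
Definition is_completed_max_unramified : Prop :=
  [/\ p%:R != 0 :> R,
      forall x : R, (forall N, pdvd N x) -> x = 0,
      forall x : nat -> R, padic_cauchy x -> exists l, padic_cvg x l
    & exists (k : closedFieldType) (pi : {rmorphism R -> k})
             (iota : {rmorphism 'F_p -> k}),
        [/\ forall c, exists x, pi x = c,
            forall x, pi x = 0 <-> pdvd 1 x
          & forall c, algebraicOver iota c]].

Definition is_frobenius_lift (phi : R -> R) : Prop :=
  bijective phi /\ forall x, pdvd 1 (phi x - x ^+ p).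

Definition root_of_unity : set R := [set z | exists2 n, (0 < n)%N & z ^+ n = 1].

(* Z_p, as the p-adic closure of Z in R *)
Definition padic_integer : set R :=
  [set x | forall N, exists m : int, pdvd N (x - m%:~R)].

(* unconditional p-adic summability *)
Definition has_padic_sum (F : R -> R) (x : R) : Prop :=
  forall N, exists s : {fset R}, forall t : {fset R},
    (s `<=` t)%fset -> pdvd N (\sum_(z <- t) F z - x).

Definition padic_sum (F : R -> R) : R := xget 0 [set x | has_padic_sum F x].

End GroundRing.

(* [u : fseries R] is the formal series \sum_(n in Z) u n q^n; the additive
   group structure is the pointwise one. *)
Notation fseries R := (int -> R) (only parsing).

Section FormalSeries.
Variables (p : nat) (R : idomainType) (phi : R -> R).
Implicit Types u : fseries R.

Definition constant_series : set (fseries R) :=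
  [set u | forall n, n != 0 -> u n = 0].
Definition qRq : set (fseries R) := [set u | forall n, n <= 0 -> u n = 0].
Definition qVRqV : set (fseries R) := [set u | forall n, 0 <= n -> u n = 0].
Definition Rq : set (fseries R) := [set u | forall n, n < 0 -> u n = 0].
Definition RqV : set (fseries R) := [set u | forall n, 0 < n -> u n = 0].
(* R((q))^ and R((q^-1))^ *)
Definition laurent_q : set (fseries R) :=
  [set u | forall N, exists M : int, forall n, n <= M -> pdvd p N (u n)].
Definition laurent_qV : set (fseries R) :=
  [set u | forall N, exists M : int, forall n, M <= n -> pdvd p N (u n)].

Definition phi_p u : fseries R :=
  fun n => if (p%:Z %| n)%Z then phi (u (n %/ p%:Z)%Z) else 0.

Definition delta_q u : fseries R := fun n => n%:~R * u n.

(* f is the element \sum_z f(z) [z] of the p-adic completion of the group ring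
   Z mu(R); p-adically only finitely many coefficients are nonzero. *)
Definition completed_group_ring (f : R -> R) : Prop :=
  [/\ forall z, ~ root_of_unity z -> f z = 0,
      forall z, padic_integer p (f z)
    & forall N, finite_set [set z | ~ pdvd p N (f z)]].

Definition convolution (f : R -> R) u : fseries R :=
  fun n => padic_sum p (fun z => f z * (z ^ n * u n)).

(* f |-> \sum_z f(z) z^kappa *)
Definition group_ring_eval (kappa : int) (f : R -> R) : R :=
  padic_sum p (fun z => f z * z ^ kappa).

End FormalSeries.

Section Characters.
Variables (p : nat) (R : idomainType) (phi : R -> R).

(* R[xi_p, xi_q] is {poly {poly R}}, with xi_p the outer variable: the
   coefficient mu_ij of xi_p^i xi_q^j is mu`_i`_j. *)
Variable mu : {poly {poly R}}.

Definition psi_a (u : fseries R) : fseries R := fun n =>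
  \sum_(i < size mu) \sum_(j < size mu`_i)
    mu`_i`_j * iter i (phi_p p phi) (iter j (@delta_q R) u) n.

Definition nondegenerate_char : Prop := mu.[0%:P].[0] \is a GRing.unit.

Definition char_ints : set int := [set kappa | mu.[0%:P].[kappa%:~R] = 0].
Definition char_ints_pos : set int := [set kappa | char_ints kappa /\ 0 < kappa].
Definition char_ints_neg : set int := [set kappa | char_ints kappa /\ kappa < 0].

Definition solutions (A : set (fseries R)) : set (fseries R) :=
  [set u | A u /\ psi_a u = 0].

Definition U_0 := solutions (@constant_series R).
Definition U_1 := solutions (@qRq R).
Definition U_m1 := solutions (@qVRqV R).
Definition U_plus := solutions (@Rq R).
Definition U_minus := solutions (@RqV R).
Definition U_right := solutions (@laurent_q p R).
Definition U_left := solutions (@laurent_qV p R).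

(* [b_step kappa b n] is the right-hand side of the recursion for b_(n, kappa)
   in terms of b_(m, kappa) = b m, m < n. *)
Definition b_step (kappa : int) (b : nat -> R) (n : nat) : R :=
  - (\sum_(1 <= s < n.+1)
       (\sum_(j < size mu`_s)
          mu`_s`_j * kappa%:~R ^+ j * p%:R ^+ (j * (n - s)))
       * iter s phi (b (n - s)%N))
  / (\sum_(j < size mu`_0) mu`_0`_j * kappa%:~R ^+ j * p%:R ^+ (j * n)).

Fixpoint b_list (kappa : int) (n : nat) : seq R :=
  if n is m.+1 then
    let b := b_list kappa m in rcons b (b_step kappa (nth 0 b) n)
  else [:: 1].

Definition b_coef (kappa : int) (n : nat) : R := (b_list kappa n)`_n.

Lemma b_coef0 kappa : b_coef kappa 0 = 1.
Proof. by []. Qed.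

Lemma size_b_list kappa n : size (b_list kappa n) = n.+1.
Proof. by elim: n => //= n IHn; rewrite size_rcons IHn. Qed.

Lemma nth_b_list kappa n m : (m <= n)%N -> (b_list kappa n)`_m = b_coef kappa m.
Proof.
elim: n => [|n IHn]; first by rewrite leqn0 => /eqP->.
rewrite leq_eqVlt => /predU1P[-> //|]; rewrite ltnS => le_mn /=.
by rewrite nth_rcons size_b_list ltnS le_mn IHn.
Qed.

Lemma b_coefS kappa n : (0 < n)%N ->
  b_coef kappa n = b_step kappa (b_coef kappa) n.
Proof.
case: n => // n _; rewrite {1}/b_coef /= nth_rcons size_b_list ltnn eqxx.
rewrite /b_step; congr (- _ / _); apply: eq_big_nat => s /andP[s1 sn].
by rewrite nth_b_list // leq_subLR -addn1 addnC leq_add2r.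
Qed.

(* u_(a, kappa, alpha), for kappa != 0: the index set of the sum giving the
   coefficient of q^m has at most one element. *)
Definition basic_series (kappa : int) (alpha : R) : fseries R := fun m =>
  \sum_(n \in [set n : nat | m = kappa * (p ^ n)%N%:Z])
    b_coef kappa n * iter n phi alpha.

End Characters.

Section DirectSums.

Definition subgroup_set (G : zmodType) (A : set G) : Prop :=
  A 0 /\ forall x y, A x -> A y -> A (x - y).

(* U is the internal direct sum of the subgroups V i, i in K. *)
Definition internal_direct_sum (G : zmodType) (I : choiceType) (K : set I)
    (V : I -> set G) (U : set G) : Prop :=
  [/\ forall i, K i -> subgroup_set (V i),
      U = [set u | exists v : I -> G,
             [/\ forall i, K i -> V i (v i),
                 finite_set [set i | K i /\ v i <> 0]
               & u = \sum_(i \in K) v i]]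
    & forall v : I -> G,
        (forall i, K i -> V i (v i)) ->
        finite_set [set i | K i /\ v i <> 0] ->
        \sum_(i \in K) v i = 0 -> forall i, K i -> v i = 0].

Definition is_module_basis (R : pzRingType) (M : lmodType R) (I : choiceType)
    (K : set I) (e : I -> M) : Prop :=
  (forall m : M, exists c : I -> R,
     finite_set [set i | K i /\ c i <> 0] /\ m = \sum_(i \in K) c i *: e i) /\
  (forall c : I -> R, finite_set [set i | K i /\ c i <> 0] ->
     \sum_(i \in K) c i *: e i = 0 -> forall i, K i -> c i = 0).

End DirectSums.

Section ConvolutionModule.
Variables (p : nat) (R : idomainType) (phi : R -> R) (mu : {poly {poly R}}).
Local Notation u_ := (basic_series p phi mu).

(* The additive isomorphism [iota : M -> U] transports to U the R-module
   structure of M.  This structure is the one given by convolution: on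
   {u_(kappa, alpha) : alpha in R}, kappa in K, an element f of the completed
   group ring acts through \sum_z f(z) z^kappa, and
   beta * u_(kappa, alpha) = u_(kappa, beta alpha). *)
Definition is_convolution_module (K : set int) (U : set (fseries R))
    (M : lmodType R) (iota : {additive M -> fseries R}) : Prop :=
  [/\ injective iota, range iota = U
    & forall kappa alpha m, K kappa -> iota m = u_ kappa alpha ->
        (forall f, completed_group_ring p f ->
           iota (group_ring_eval p kappa f *: m)
             = convolution p f (u_ kappa alpha)) /\
        (forall beta, iota (beta *: m) = u_ kappa (beta * alpha))].

Definition free_under_convolution (K : set int) (U : set (fseries R)) : Prop :=
  exists (M : lmodType R) (iota : {additive M -> fseries R}),
    is_convolution_module K U iota /\
    exists e : int -> M,
      (forall kappa, K kappa -> iota (e kappa) = u_ kappa 1) /\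
      is_module_basis K e.

End ConvolutionModule.

(* Main.v *)
Require Import Defs.
From HB Require Import structures.
From mathcomp Require Import all_boot all_order all_algebra.
From mathcomp Require Import finmap.
From mathcomp Require Import mathcomp_extra boolp classical_sets functions.
From mathcomp Require Import cardinality fsbigop.
From mathcomp Require Import ring.

Set Implicit Arguments.
Unset Strict Implicit.
Unset Printing Implicit Defensive.

Import Order.TTheory GRing.Theory Num.Theory.
Local Open Scope classical_set_scope.
Local Open Scope ring_scope.

(* At q^n the equation psi_a u = 0 reads
     sum over i with p^i | n of mu_i(n / p^i) phi^i(u_(n / p^i)) = 0,
   mu_i(x) being the coefficient of xi_p^i in mu(xi_p, x).  It never mixes
   coefficients whose indices have different signs, so a solution splits into a
   solution in R[[q]] and one in q^-1 R[[q^-1]].  For n <> 0 with mu_0(n) <> 0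
   it determines u_n from the u_(n / p^i), i > 0; hence, apart from u_0, a
   solution is determined by its values at the finitely many characteristic
   integers kappa.  Since mu_0(n) = mu(0, 0) modulo p when p | n, these are
   prime to p and the denominators of b_(n, kappa) are units, so u_(kappa, alpha)
   exists, takes the value alpha at kappa and vanishes at the other
   characteristic integers.  The convolution formula reduces to
   phi(zeta) = zeta^p for roots of unity zeta, which uses that p is odd. *)

(** * Iterates of a ring endomorphism as ring endomorphisms *)

Section IterMorphism.
Variables (R : pzRingType) (phi : {rmorphism R -> R}).

Fact iter_zmod_morphism n : zmod_morphism (iter n phi).
Proof. by elim: n => // n IHn x y /=; rewrite IHn rmorphB. Qed.

Fact iter_monoid_morphism n : monoid_morphism (iter n phi).
Proof.
elim: n => // n [IH1 IHM]; split=> [|x y] /=; first by rewrite IH1 rmorph1.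
by rewrite IHM rmorphM.
Qed.

HB.instance Definition _ n :=
  GRing.isZmodMorphism.Build R R (iter n phi) (iter_zmod_morphism n).
HB.instance Definition _ n :=
  GRing.isMonoidMorphism.Build R R (iter n phi) (iter_monoid_morphism n).

End IterMorphism.

(** * Divisibility by powers of [p], p-adic sums and units *)

Section PadicDivisibility.
Variables (p : nat) (R : idomainType).
Implicit Types (x y : R) (F : R -> R).

Lemma pdvd0 N : pdvd p N (0 : R).
Proof. by exists 0; rewrite mulr0. Qed.

Lemma pdvdD N x y : pdvd p N x -> pdvd p N y -> pdvd p N (x + y).
Proof. by move=> [c ->] [d ->]; exists (c + d); rewrite mulrDr. Qed.

Lemma pdvdMr N x y : pdvd p N x -> pdvd p N (x * y).
Proof. by move=> [c ->]; exists (c * y); rewrite mulrA. Qed.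

Lemma pdvdMl N x y : pdvd p N x -> pdvd p N (y * x).
Proof. by rewrite mulrC; exact: pdvdMr. Qed.

Lemma pdvdN N x : pdvd p N x -> pdvd p N (- x).
Proof. by rewrite -mulN1r; exact: pdvdMl. Qed.

Lemma pdvdB N x y : pdvd p N x -> pdvd p N y -> pdvd p N (x - y).
Proof. by move=> px /pdvdN; exact: pdvdD. Qed.

Lemma pdvd_sum N (I : Type) (r : seq I) (P : pred I) (G : I -> R) :
  (forall i, P i -> pdvd p N (G i)) -> pdvd p N (\sum_(i <- r | P i) G i).
Proof. by move=> pG; elim/big_ind: _ => //; [exact: pdvd0 | exact: pdvdD]. Qed.

Lemma pdvd_leq M N x : (M <= N)%N -> pdvd p N x -> pdvd p M x.
Proof.
move=> leMN [c ->]; exists (p%:R ^+ (N - M) * c).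
by rewrite mulrA -exprD subnKC.
Qed.

Lemma pdvd_rmorph N (f : {rmorphism R -> R}) x : pdvd p N x -> pdvd p N (f x).
Proof. by move=> [c ->]; exists (f c); rewrite rmorphM rmorphXn rmorph_nat. Qed.

(** Both sums are compared with the partial sum over the union of their two finite index sets. *)
Lemma pdvd_has_padic_sum N F x y :
  has_padic_sum p F x -> has_padic_sum p F y -> pdvd p N (x - y).
Proof.
move=> /(_ N)[s sx] /(_ N)[t ty].
have -> : x - y = (\sum_(z <- (s `|` t)%fset) F z - y) -
  (\sum_(z <- (s `|` t)%fset) F z - x) by ring.
by apply: pdvdB; [apply: ty; exact: fsubsetUr | apply: sx; exact: fsubsetUl].
Qed.

Lemma has_padic_sumMl F x c :
  has_padic_sum p F x -> has_padic_sum p (fun z => c * F z) (c * x).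
Proof.
move=> Fx N; have [s sP] := Fx N; exists s => t st.
by rewrite -mulr_sumr -mulrBr; apply: pdvdMl; exact: sP.
Qed.

Lemma has_padic_sum_rmorph F x (f : {rmorphism R -> R}) :
  has_padic_sum p F x -> has_padic_sum p (fun z => f (F z)) (f x).
Proof.
move=> Fx N; have [s sP] := Fx N; exists s => t st.
by rewrite -rmorph_sum -rmorphB; apply: pdvd_rmorph; exact: sP.
Qed.

Hypothesis separated : forall x, (forall N, pdvd p N x) -> x = 0.
Hypothesis complete :
  forall x : nat -> R, padic_cauchy p x -> exists l, padic_cvg p x l.

Lemma padic_sumE F x : has_padic_sum p F x -> padic_sum p F = x.
Proof.
move=> Fx; apply: xget_unique => // y Fy.
by apply/eqP; rewrite -subr_eq0; apply/eqP/separated => N;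
  exact: pdvd_has_padic_sum Fy Fx.
Qed.

(** The inverse is the geometric series in [d = - p c]: its partial sums are Cauchy, and
    separatedness shows that their limit is an inverse. *)
Lemma unit_1_plus_p c : 1 + p%:R * c \is a @GRing.unit R.
Proof.
set d := - (p%:R * c).
have pd n : pdvd p n (d ^+ n).
  by exists ((- c) ^+ n); rewrite -exprMn mulrN.
pose s n : R := \sum_(i < n) d ^+ i.
have sB N n : (N <= n)%N -> pdvd p N (s n - s N).
  move=> leNn; rewrite /s -(subnKC leNn) big_split_ord /= addrAC subrr add0r.
  apply: pdvd_sum => i _; apply: pdvd_leq (pd _); exact: leq_addr.
have [|l sl] := complete (x := s).
  move=> N; exists N => m n /sB sm /sB sn.
  by have := pdvdB sm sn; rewrite opprB addrA addrNK.
suff: (1 + p%:R * c) * l = 1 by move=> E; apply/unitrPr; exists l.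
apply/eqP; rewrite -subr_eq0; apply/eqP/separated => N.
(* At the index [maxn M N] both the distance to [l] and the remainder of the geometric sum are
   divisible by [p ^ N]. *)
have [M /(_ (maxn M N) (leq_maxl _ _)) sM] := sl N.
have sE : (1 + p%:R * c) * s (maxn M N) = 1 - d ^+ maxn M N.
  by rewrite -opprB subrX1 -mulNr opprB opprK.
have -> : (1 + p%:R * c) * l - 1 = - (d ^+ maxn M N) -
    (1 + p%:R * c) * (s (maxn M N) - l).
  by rewrite mulrBr sE; ring.
by apply: pdvdB; [apply/pdvdN/(pdvd_leq _ (pd _))/leq_maxr | exact: pdvdMl].
Qed.

(** Let [s N] be the finite set of indices whose terms are not divisible by [p ^ N]. Any finite set
    containing [s N] gives the same partial sum modulo [p ^ N], so the sums over the increasing sets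
    [s N] are Cauchy and their limit is the sum. *)
Lemma has_padic_sum_exists F :
  (forall N, finite_set [set z | ~ pdvd p N (F z)]) ->
  exists x, has_padic_sum p F x.
Proof.
move=> finF; pose s N := fset_set [set z | ~ pdvd p N (F z)].
have sP N z : z \notin s N -> pdvd p N (F z).
  by rewrite in_fset_set // notin_setE => /contrapT.
have sB N t : (s N `<=` t)%fset ->
    pdvd p N (\sum_(z <- t) F z - \sum_(z <- s N) F z).
  move=> st; rewrite (big_fsetID _ (mem (s N))) /=.
  have -> : [fset z in t | z \in s N]%fset = s N.
    apply/fsetP => z; rewrite !inE /= andbC; case: (boolP (z \in s N)) => //=.
    by move/(fsubsetP st).
  rewrite addrAC subrr add0r big_seq; apply: pdvd_sum => z.
  by rewrite !inE => /andP[_ /sP].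
have s_leq M N : (M <= N)%N -> (s M `<=` s N)%fset.
  move=> leMN; apply/fsubsetP => z; rewrite !in_fset_set // !inE.
  by move=> nM /(pdvd_leq leMN).
have [|x sx] := complete (x := fun N => \sum_(z <- s N) F z).
  move=> N; exists N => m n /s_leq /sB sm /s_leq /sB sn.
  by have := pdvdB sm sn; rewrite opprB addrA addrNK.
exists x => N; exists (s N) => t /sB tN.
have [M /(_ (maxn M N) (leq_maxl _ _)) sM] := sx N.
have /s_leq /sB sN := leq_maxr M N.
by have := pdvdD (pdvdB tN sN) sM; rewrite opprB !addrA !addrNK.
Qed.

End PadicDivisibility.

(** * Characteristic, roots of unity and the Frobenius lift on [R] *)

Section CompletedMaxUnramified.
Variables (p : nat) (R : idomainType).
Hypotheses (p_prime : prime p) (Rcmu : is_completed_max_unramified p R).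

Lemma cmu_separated (x : R) : (forall N, pdvd p N x) -> x = 0.
Proof. by case: Rcmu => _ sep _ _; exact: sep. Qed.

Lemma cmu_complete (x : nat -> R) :
  padic_cauchy p x -> exists l, padic_cvg p x l.
Proof. by case: Rcmu => _ _ compl _; exact: compl. Qed.

Lemma cmu_p_neq0 : p%:R != 0 :> R.
Proof. by case: Rcmu. Qed.

(** The residue field has characteristic [p], because [pi] kills [p]. *)
Lemma pdvd1_nat n : pdvd p 1 (n%:R : R) -> (p %| n)%N.
Proof.
case: Rcmu => _ _ _ [k [pi [iota [_ piP _]]]] /piP.
have pk : p \in [pchar k].
  by rewrite inE p_prime -(rmorph_nat pi); apply/eqP/piP; exists 1;
    rewrite mulr1.
by rewrite rmorph_nat => /eqP; rewrite -(dvdn_pcharf pk).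
Qed.

(** If a positive integer vanished in [R], so would some prime [q]. Then [p] divides [q] in [R],
    hence [q = p], which is nonzero in [R]. *)
Lemma cmu_natr_eq0 n : (n%:R == 0 :> R) = (n == 0)%N.
Proof.
apply/idP/eqP => [|->//]; case: (posnP n) => // n_gt0 /(natf0_pchar n_gt0)[q].
rewrite inE => /andP[q_prime q0]; have := q0; rewrite (eqP q0).
have /pdvd1_nat : pdvd p 1 (q%:R : R) by rewrite (eqP q0); exact: pdvd0.
rewrite dvdn_prime2 // => /eqP pq.
by move: cmu_p_neq0; rewrite pq q0.
Qed.

Lemma cmu_intr_inj : injective (intr : int -> R).
Proof.
move=> m n /eqP; rewrite -subr_eq0 -rmorphB => /eqP mn0.
suff: m - n == 0 by rewrite subr_eq0 => /eqP.
rewrite -absz_eq0 -cmu_natr_eq0.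
move: mn0; case: (m - n) => k /=; first by move=> /eqP.
by rewrite NegzE rmorphN => /eqP; rewrite oppr_eq0.
Qed.

Hypothesis p_neq2 : (p != 2)%N.

(** In a domain, [w ^+ l - 1] being [w - 1] times the sum of the [w ^+ i], [i < l], it suffices that
    this sum is nonzero. It is [l] modulo [p], which settles [l != p]; for [l = p] one works modulo
    [p ^ 2]. *)
Lemma unity_root_prime_1_plus_p (w : R) l :
  prime l -> w ^+ l = 1 -> pdvd p 1 (w - 1) -> w = 1.
Proof.
move=> l_prime wl1 w1.
suff S_neq0 : \sum_(i < l) w ^+ i != 0.
  apply/eqP; rewrite -subr_eq0; have /eqP := subrX1 w l.
  by rewrite wl1 subrr eq_sym mulf_eq0 (negPf S_neq0) orbF.
have [lp|l_neqp] := eqVneq l p; last first.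
  apply/negP => /eqP S0; case/negP: (l_neqp); rewrite eq_sym -dvdn_prime2 //.
  apply: pdvd1_nat.
  have -> : l%:R = - \sum_(i < l) (w ^+ i - 1).
    by rewrite sumrB S0 sumr_const card_ord sub0r opprK.
  by apply/pdvdN/pdvd_sum => i _; rewrite subrX1; exact: pdvdMr.
(* With w = 1 + p c, [w ^+ i = 1 + i p c] modulo p^2, and p divides
   [0 + 1 + ... + (p - 1)] because p is odd; hence the sum is p times a unit. *)
have [c /eqP] := w1; rewrite expr1 subr_eq => /eqP wE.
have wi i : pdvd p 2 (w ^+ i - (1 + i%:R * (p%:R * c))).
  elim: i => [|i [d /eqP]]; first by exists 0; rewrite expr0; ring.
  rewrite subr_eq => /eqP iE; exists (i%:R * c ^+ 2 + d + p%:R * c * d).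
  by rewrite exprS iE wE -natr1; ring.
have [D DE] : pdvd p 2 (\sum_(i < p) (w ^+ i - (1 + i%:R * (p%:R * c)))).
  by apply: pdvd_sum => i _; exact: wi.
have SE : \sum_(i < l) w ^+ i = p%:R * (1 + p%:R * (p.-1./2%:R * c + D)).
  have <- : p%:R + (p * p.-1./2)%:R * (p%:R * c) + p%:R ^+ 2 * D =
      p%:R * (1 + p%:R * (p.-1./2%:R * c + D)) by rewrite natrM; ring.
  rewrite -DE lp sumrB big_split /= sumr_const card_ord -mulr_suml -natr_sum.
  have -> : (\sum_(i < p) i = p * p.-1./2)%N.
    rewrite -(big_mkord xpredT id) bin2_sum bin2odd //.
    by apply: contraNT p_neq2 => /(prime_oddPn p_prime)/eqP.
  by rewrite [RHS]addrC addrNK.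
rewrite SE mulf_neq0 ?cmu_p_neq0 //; apply: contraTneq isT => U0.
by have := unit_1_plus_p cmu_separated cmu_complete (p.-1./2%:R * c + D);
  rewrite U0 unitr0.
Qed.

(** Induction on [n]: if [n = m l] with [l] prime, then [w ^+ m] is an [l]-th root of unity
    congruent to 1 modulo [p], so [w ^+ m = 1] by the prime case. *)
Lemma unity_root_1_plus_p (w : R) n :
  (0 < n)%N -> w ^+ n = 1 -> pdvd p 1 (w - 1) -> w = 1.
Proof.
elim/ltn_ind: n w => n IHn w n_gt0 wn1 w1.
have [n1|n_neq1] := eqVneq n 1%N; first by move: wn1; rewrite n1 expr1.
have [|l l_prime /dvdnP[m nE]] := @pdivP n.
  by rewrite ltn_neqAle eq_sym n_neq1.
move: n_gt0; rewrite nE muln_gt0 => /andP[m_gt0 l_gt0].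
apply: (IHn m) => //; first by rewrite nE ltn_Pmulr // prime_gt1.
apply: (unity_root_prime_1_plus_p l_prime); first by rewrite -exprM -nE.
by rewrite subrX1; exact: pdvdMr.
Qed.

(* Unqualified, [root_of_unity] is the predicate of the poly library. *)
Lemma root_of_unity_unit (z : R) : Defs.root_of_unity z -> z \is a GRing.unit.
Proof. by case=> n n_gt0 zn1; rewrite -(unitrX_pos _ n_gt0) zn1 unitr1. Qed.

Variable phi : {rmorphism R -> R}.
Hypothesis phi_lift : is_frobenius_lift p phi.

(* phi z / z ^ p is a root of unity congruent to 1 modulo p, and 1 is the only
   one since p is odd *)
Lemma frobenius_lift_root_of_unity (z : R) :
  Defs.root_of_unity z -> phi z = z ^+ p.
Proof.
move=> zmu; have zU := root_of_unity_unit zmu; case: zmu => n n_gt0 zn1.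
have zpU : z ^+ p \is a GRing.unit by rewrite unitrX.
suff zp1 : phi z / z ^+ p = 1 by rewrite -[LHS](divrK zpU) zp1 mul1r.
apply: (unity_root_1_plus_p n_gt0).
  by rewrite exprMn -rmorphXn exprVn exprAC zn1 rmorph1 expr1n invr1 mulr1.
have -> : phi z / z ^+ p - 1 = (phi z - z ^+ p) / z ^+ p.
  by rewrite mulrBl divrr.
by apply: pdvdMr; case: phi_lift.
Qed.

Lemma iter_frobenius_root_of_unity (z : R) m :
  Defs.root_of_unity z -> iter m phi z = z ^+ (p ^ m).
Proof.
move=> zmu; elim: m => [|m IHm]; first by rewrite expn0 expr1.
by rewrite iterS IHm rmorphXn frobenius_lift_root_of_unity // -exprM expnS.
Qed.

(** A ring endomorphism fixes the integers and preserves divisibility by [p ^ N], so it fixes their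
    p-adic limits. *)
Lemma frobenius_lift_padic_integer (x : R) : padic_integer p x -> phi x = x.
Proof.
move=> xZp; apply/eqP; rewrite -subr_eq0; apply/eqP/cmu_separated => N.
have [m xm] := xZp N; have := pdvdB (pdvd_rmorph phi xm) xm.
by rewrite rmorphB rmorph_int opprB addrA addrNK.
Qed.

End CompletedMaxUnramified.

(** * Coefficients of [psi_a u] and of the basic series *)

Section Character.
Variables (p : nat) (R : idomainType) (phi : {rmorphism R -> R}).
Variable mu : {poly {poly R}}.
Hypothesis p_gt1 : (1 < p)%N.
Implicit Types (u : int -> R) (kappa n : int).
Local Notation b_ := (b_coef p phi mu).
Local Notation u_ := (basic_series p phi mu).
Local Notation "p ^: i" := ((p ^ i)%N%:Z) (at level 29, left associativity).

Lemma expp_neq0 i : p ^: i != 0.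
Proof. by rewrite eqz_nat -lt0n expn_gt0 ltnW. Qed.

Lemma iter_delta_qE j u n : iter j (@delta_q R) u n = n%:~R ^+ j * u n.
Proof.
elim: j => [|j IHj]; first by rewrite expr0 mul1r.
by rewrite iterS /delta_q IHj exprS mulrA.
Qed.

Lemma iter_phi_pE i u n : iter i (phi_p p phi) u n =
  if (p ^: i %| n)%Z then iter i phi (u (n %/ p ^: i)%Z) else 0.
Proof.
elim: i n => [|i IHi] n; first by rewrite expn0 dvd1z divz1.
have pi1 : p ^: i.+1 = p ^: i * p%:Z by rewrite expnSr PoszM.
have p_gt0 : (0 < p%:Z)%R by rewrite ltz_nat ltnW.
rewrite iterS /phi_p; case: ifPn => [/dvdzP[m ->]|pn]; last first.
  rewrite ifN //; apply: contra pn; apply: dvdz_trans.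
  by rewrite pi1 dvdz_mull.
rewrite IHi mulzK ?gt_eqF // pi1 dvdz_mul2r ?gt_eqF // divzMpr //.
by case: ifP => // _; rewrite rmorph0.
Qed.

(** The factor [n / p ^ i] enters through [delta_q], and [phi] fixes it. The bound [N] is left free
    so that the range can be made to contain [i = 0] even if [mu = 0], or all [i <= m]. *)
Lemma psi_aE N u n : (size mu <= N)%N -> psi_a p phi mu u n =
  \sum_(i < N) if (p ^: i %| n)%Z then
    (mu`_i).[(n %/ p ^: i)%Z%:~R] * iter i phi (u (n %/ p ^: i)%Z) else 0.
Proof.
move=> leN; rewrite /psi_a.
pose F i := if (p ^: i %| n)%Z then
    (mu`_i).[(n %/ p ^: i)%Z%:~R] * iter i phi (u (n %/ p ^: i)%Z) else 0.
rewrite -[RHS]/(\sum_(i < N) F i).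
rewrite (big_ord_widen N (fun i => \sum_(j < size mu`_i)
    mu`_i`_j * iter i (phi_p p phi) (iter j (@delta_q R) u) n)) //.
rewrite big_mkcond; apply: eq_bigr => i _; rewrite /F; case: ltnP => [_|lei].
  case: ifP => pn; last by rewrite big1 // => j _; rewrite iter_phi_pE pn mulr0.
  rewrite horner_coef mulr_suml; apply: eq_bigr => j _.
  by rewrite iter_phi_pE pn iter_delta_qE rmorphM rmorphXn rmorph_int mulrA.
by rewrite nth_default // horner0 mul0r if_same.
Qed.

Lemma psi_aB u v : psi_a p phi mu (u - v) = psi_a p phi mu u - psi_a p phi mu v.
Proof.
apply/funext => n; rewrite [RHS]/GRing.add /= /GRing.opp /=.
rewrite !(psi_aE _ _ (leqnn _)) -sumrB; apply: eq_bigr => i _.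
by case: ifP => _; rewrite ?subr0 // -mulrBr -rmorphB.
Qed.

(** The coefficient at [n] only involves [u] at the integers [n / p ^ i], where [D] takes the same
    value as at [n]. The sign of the index is such a [D]. *)
Lemma psi_a_restrict (D : pred int) u :
  (forall n i, D (n * p ^: i) = D n) ->
  psi_a p phi mu (fun n => if D n then u n else 0) =
  (fun n => if D n then psi_a p phi mu u n else 0).
Proof.
move=> Dp; apply/funext => n; rewrite !(psi_aE _ _ (leqnn _)).
transitivity (\sum_(i < size mu) if D n then
    (if (p ^: i %| n)%Z then
       (mu`_i).[(n %/ p ^: i)%Z%:~R] * iter i phi (u (n %/ p ^: i)%Z) else 0)
  else 0); last by case: ifP => // _; rewrite big1.
apply: eq_bigr => i _; case: ifPn => [/dvdzP[m ->]|]; last by rewrite if_same.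
by rewrite mulzK ?expp_neq0 // Dp; case: ifP => // _; rewrite rmorph0 mulr0.
Qed.

Lemma char_intsE kappa : char_ints mu kappa <-> (mu`_0).[kappa%:~R] = 0.
Proof. by rewrite /char_ints /= horner_coef0. Qed.

(* The equation at q^n expresses mu`_0(n) u_n through the u_(n / p^i), i > 0. *)
Lemma psi_a_eq0_char_ints u : psi_a p phi mu u = 0 ->
  (forall kappa, char_ints mu kappa -> u kappa = 0) ->
  forall n, n != 0 -> u n = 0.
Proof.
move=> psiu uK n; have [k] := ubnP `|n|%N; elim: k n => // k IHk n nk n0.
(* For [i > 0] the index [n / p ^ i] is nonzero and smaller than [n] in absolute value, so these
   terms vanish by induction and mu_0(n) u_n = 0 is left. *)
have := congr1 (@^~ n) psiu; rewrite /= (psi_aE _ _ (leqnSn _)) big_ord_recl.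
rewrite expn0 dvd1z divz1 big1 ?addr0 => [|i _]; last first.
  case: ifP => // /dvdzP[m nE]; rewrite {2}nE mulzK ?expp_neq0 // IHk.
  - by rewrite rmorph0 mulr0.
  - rewrite ltnS in nk; apply: leq_trans nk; rewrite nE abszM ltn_Pmulr //=.
      rewrite /bump /= add1n expnS; apply: leq_trans p_gt1 _.
      by rewrite leq_pmulr // expn_gt0 ltnW.
    rewrite absz_gt0; apply: contra_neq n0 => m0; by rewrite nE m0 mul0r.
  - by apply: contra_neq n0 => m0; rewrite nE m0 mul0r.
move=> /eqP; rewrite mulf_eq0 => /orP[/eqP/char_intsE/uK //|/eqP //].
Qed.

(** The exponents [kappa * p ^ n] are pairwise distinct, so the defining sum has a single term. *)
Lemma basic_seriesE kappa alpha m : kappa != 0 ->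
  u_ kappa alpha (kappa * p ^: m) = b_ kappa m * iter m phi alpha.
Proof.
move=> kappa0; rewrite /basic_series.
suff -> : [set n : nat | kappa * p ^: m = kappa * p ^: n] = [set m].
  by rewrite fsbig_set1.
apply/seteqP; split=> [n /= /(mulfI kappa0)[/eqP]|n /= -> //].
by rewrite eqn_exp2l // => /eqP.
Qed.

Lemma basic_series_out kappa alpha n :
  (forall m, n <> kappa * p ^: m) -> u_ kappa alpha n = 0.
Proof.
move=> nE; rewrite /basic_series.
suff -> : [set m : nat | n = kappa * p ^: m] = set0 by rewrite fsbig_set0.
by apply/seteqP; split=> m //= /nE.
Qed.

Lemma basic_seriesB kappa alpha beta : kappa != 0 ->
  u_ kappa (alpha - beta) = u_ kappa alpha - u_ kappa beta.
Proof.
move=> kappa0; apply/funext => n; rewrite [RHS]/GRing.add /= /GRing.opp /=.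
have [[m ->]|nE] := pselect (exists m, n = kappa * p ^: m).
  by rewrite !basic_seriesE // rmorphB mulrBr.
by rewrite !basic_series_out ?subr0 // => m nm; apply: nE; exists m.
Qed.

End Character.

(** * Characteristic integers, their basic series, and convolution *)

Section Solutions.
Variables (p : nat) (R : idomainType) (phi : {rmorphism R -> R}).
Variable mu : {poly {poly R}}.
Hypotheses (p_prime : prime p) (Rcmu : is_completed_max_unramified p R).
Hypothesis mu_nondeg : nondegenerate_char mu.
Implicit Types (u v : int -> R) (kappa n : int) (A : set int) (c : int -> R).
Local Notation b_ := (b_coef p phi mu).
Local Notation u_ := (basic_series p phi mu).
Local Notation K := (char_ints mu).
Local Notation "p ^: i" := ((p ^ i)%N%:Z) (at level 29, left associativity).

Let p_gt1 : (1 < p)%N := prime_gt1 p_prime.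

(** With a = mu_0(0), a unit by non-degeneracy, mu_0(n) has the form a (1 + p c). *)
Lemma mu0_unit n : (p%:Z %| n)%Z -> (mu`_0).[n%:~R] \is a GRing.unit.
Proof.
move: mu_nondeg; rewrite /nondegenerate_char polyC0 (horner_coef0 mu) => mu00U.
case/dvdzP => m ->.
have /factor_theorem[q qE] : root (mu`_0 - ((mu`_0).[0])%:P) 0.
  by rewrite /root !hornerE subrr.
have -> : mu`_0 = q * ('X - 0%:P) + ((mu`_0).[0])%:P by rewrite -qE subrK.
set a := (mu`_0).[0] in mu00U *; rewrite !hornerE rmorphM /= subr0.
have -> : q.[m%:~R * p%:~R] * (m%:~R * p%:~R) + a =
    a * (1 + p%:R * (a^-1 * (q.[m%:~R * p%:~R] * m%:~R))).
  rewrite mulrDr mulr1 addrC; congr (_ + _).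
  rewrite [RHS]mulrCA mulVKr //.
  by rewrite -!pmulrn; ring.
rewrite unitrM mu00U.
exact: (unit_1_plus_p (cmu_separated Rcmu) (cmu_complete Rcmu)).
Qed.

Lemma char_ints_ndvd kappa : K kappa -> ~~ (p%:Z %| kappa)%Z.
Proof.
by move=> /char_intsE kappaK; apply: contraPN kappaK => /mu0_unit + E;
  rewrite E unitr0.
Qed.

Lemma char_ints_neq0 kappa : K kappa -> kappa != 0.
Proof. by move/char_ints_ndvd; apply: contraNneq => ->; rewrite dvdz0. Qed.

(** Characteristic integers are roots of mu_0, which is nonzero since its value at 0 is a unit;
    distinct integers stay distinct in [R]. *)
Lemma finite_char_ints : finite_set K.
Proof.
apply: contrapT => /(infinite_set_fset (size mu`_0))[B BK].
have mu0_neq0 : mu`_0 != 0.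
  by apply: contraTneq (mu0_unit (dvdz0 p)) => ->; rewrite horner0 unitr0.
apply/negP; rewrite -ltnNge -(size_map (intr : int -> R)).
apply: max_poly_roots => //; last first.
  by rewrite map_inj_uniq ?fset_uniq //; exact: cmu_intr_inj Rcmu.
by apply/allP => _ /mapP[kappa /BK/char_intsE kappaK ->]; apply/rootP.
Qed.

(** For [m > 0] the exponent [kappa * p ^ m] is divisible by [p], hence not characteristic; only the
    leading exponent [kappa] can equal [kappa']. *)
Lemma basic_series_char_ints kappa kappa' alpha : K kappa -> K kappa' ->
  u_ kappa alpha kappa' = if kappa' == kappa then alpha else 0.
Proof.
move=> kappaK kappaK'; have kappa0 := char_ints_neq0 kappaK.
case: eqP => [->|ne].
  have := basic_seriesE phi mu p_gt1 alpha 0 kappa0.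
  by rewrite expn0 mulr1 b_coef0 mul1r.
apply: basic_series_out => -[|m] E; first by apply: ne; rewrite E mulr1.
case/negP: (char_ints_ndvd kappaK').
by rewrite E expnS PoszM dvdz_mull // dvdz_mulr.
Qed.

(** For [m > 0] this is the recursion for [b_] cleared of its denominator; for [m = 0] it says that
    [kappa] is characteristic. *)
Lemma b_coef_recursion kappa m : K kappa ->
  \sum_(i < m.+1) (mu`_i).[(kappa * p ^: (m - i))%:~R] *
    iter i phi (b_ kappa (m - i)) = 0.
Proof.
move=> kappaK.
(* The inner sums of [b_step] are the values of mu_s at [kappa * p ^ k]. *)
have muE s k : \sum_(j < size mu`_s)
    mu`_s`_j * kappa%:~R ^+ j * p%:R ^+ (j * k) =
    (mu`_s).[(kappa * p ^: k)%:~R].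
  rewrite horner_coef; apply: eq_bigr => j _.
  rewrite -mulrA; congr (_ * _).
  by rewrite rmorphM /= exprMn; congr (_ * _);
    rewrite -pmulrn natrX -exprM mulnC.
have [->|m_gt0] := posnP m.
  by rewrite big_ord1 /= subnn mulr1 (mulr1 kappa); apply/char_intsE.
rewrite -(big_mkord xpredT (fun i => (mu`_i).[(kappa * p ^: (m - i))%:~R] *
    iter i phi (b_ kappa (m - i)))) big_ltn // subn0 /= b_coefS // /b_step.
(* The denominator mu_0(kappa p^m) is a unit because [m > 0]. *)
rewrite muE [X in X + _]mulrC divrK; last first.
  apply: mu0_unit; rewrite dvdz_mull //; case: (m) m_gt0 => // k _.
  by rewrite expnS PoszM dvdz_mulr.
by apply/eqP; rewrite addrC subr_eq0; apply/eqP/eq_bigr => s _; rewrite muE.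
Qed.

(** At [kappa * p ^ m] the terms with [i <= m] add up to the identity [b_coef_recursion] times
    phi^m(alpha). Those with [i > m] vanish because [p] does not divide [kappa]. *)
Lemma psi_a_basic_series kappa alpha :
  K kappa -> psi_a p phi mu (u_ kappa alpha) = 0.
Proof.
move=> kappaK; have kappa0 := char_ints_neq0 kappaK.
apply/funext => n.
have [[m ->]|nE] := pselect (exists m, n = kappa * p ^: m); last first.
  rewrite (psi_aE _ p_gt1 _ _ (leqnn _)) big1 // => i _.
  case: ifP => // /dvdzP[k kE].
  rewrite {2}kE mulzK ?expp_neq0 // basic_series_out ?rmorph0 ?mulr0 // => j E.
  by apply: nE; exists (j + i)%N; rewrite kE E expnD PoszM mulrA.
rewrite (psi_aE _ p_gt1 _ _ (leq_maxl _ m.+1)).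
pose F i := (mu`_i).[(kappa * p ^: (m - i))%:~R] *
    iter i phi (b_ kappa (m - i)) * iter m phi alpha.
transitivity (\sum_(i < maxn (size mu) m.+1) if (i < m.+1)%N then F i else 0).
  apply: eq_bigr => i _; rewrite ltnS; case: leqP => [leim|ltmi].
    have -> : kappa * p ^: m = kappa * p ^: (m - i) * p ^: i.
      by rewrite -mulrA -PoszM -expnD subnK.
    rewrite dvdz_mull // mulzK ?expp_neq0 // basic_seriesE //.
    rewrite (rmorphM (iter i phi)) mulrA; congr (_ * _).
    by rewrite -[in RHS](subnKC leim) iterD.
  rewrite ifN // -(subnKC ltmi) addSnnS addnC expnD PoszM.
  rewrite dvdz_mul2r ?expp_neq0 // expnS PoszM.
  by apply: contra (char_ints_ndvd kappaK); apply: dvdz_trans; exact: dvdz_mulr.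
rewrite -big_mkcond -(big_ord_widen _ F) ?leq_maxr //.
by rewrite -mulr_suml b_coef_recursion // mul0r.
Qed.

(** Let [S] be the sum of f(z) z^kappa. At [kappa * p ^ m], phi^m sends z^kappa to its [p ^ m]-th
    power and fixes f(z), so applying phi^m termwise to the sum [alpha * S] produces the convolution
    coefficient, up to the factor [b_ kappa m]. *)
Lemma convolution_basic_series (f : R -> R) kappa alpha :
  (p != 2)%N -> is_frobenius_lift p phi -> K kappa ->
  completed_group_ring p f ->
  convolution p f (u_ kappa alpha) =
  u_ kappa (group_ring_eval p kappa f * alpha).
Proof.
move=> p_neq2 phi_lift kappaK [f_supp f_Zp f_fin].
have kappa0 := char_ints_neq0 kappaK.
have sumE := padic_sumE (cmu_separated Rcmu).
have [|S S_sum] :=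
    has_padic_sum_exists (cmu_complete Rcmu) (F := fun z => f z * z ^ kappa).
  move=> N; apply: sub_finite_set (f_fin N) => z /=; apply: contra_not.
  exact: pdvdMr.
rewrite /group_ring_eval (sumE _ _ S_sum); apply/funext => n.
rewrite /convolution.
have [[m ->]|nE] := pselect (exists m, n = kappa * p ^: m); last first.
  have u0 beta : u_ kappa beta n = 0.
    by apply: basic_series_out => m nm; apply: nE; exists m.
  rewrite u0 [RHS]u0; apply: sumE => N; exists fset0 => t _.
  by rewrite big1 ?subr0 => [|z _]; [exact: pdvd0 | rewrite !mulr0].
rewrite !basic_seriesE // [S * _]mulrC.
have := has_padic_sumMl (b_ kappa m)
  (has_padic_sum_rmorph (iter m phi) (has_padic_sumMl alpha S_sum)).
move=> /sumE <-; congr padic_sum; apply/funext => z /=.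
have [zmu|/f_supp ->] := pselect (Defs.root_of_unity z); last first.
  by rewrite !mul0r mulr0 rmorph0 mulr0.
have fz : iter m phi (f z) = f z.
  by elim: m => //= k ->;
    exact: (frobenius_lift_padic_integer Rcmu phi (f_Zp z)).
have iterM x y : iter m phi (x * y) = iter m phi x * iter m phi y.
  exact: rmorphM.
have zkappa : iter m phi (z ^ kappa) = z ^ (kappa * p ^: m).
  rewrite (rmorphXz (iter m phi)) ?(root_of_unity_unit zmu) //=.
  by rewrite (iter_frobenius_root_of_unity p_prime) // exprnP exprz_exp mulrC.
by rewrite !iterM fz zkappa; ring.
Qed.

(** * Solutions supported on nonzero indices of one sign *)

Section SupportedSolutions.
Variable A : set int.
Hypotheses (A_neq0 : forall n, A n -> n != 0)
  (A_expp : forall n m, A n -> A (n * p ^: m)).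
(** Taking for [A] the positive or the negative integers treats [U_1] and [U_m1] by one argument. *)
Let KA : set int := [set kappa | K kappa /\ A kappa].
Let UA := solutions p phi mu [set u | forall n, ~ A n -> u n = 0].

Lemma finite_KA : finite_set KA.
Proof. by apply: sub_finite_set finite_char_ints => kappa []. Qed.

Lemma finite_KA_sub (P : int -> Prop) :
  finite_set [set i | KA i /\ P i].
Proof. by apply: sub_finite_set finite_KA => i []. Qed.

Lemma supported_solutionsB u v : UA u -> UA v -> UA (u - v).
Proof.
move=> [uA psiu] [vA psiv]; split=> [n nA|].
  by rewrite /GRing.add /= /GRing.opp /= uA // vA // subr0.
by rewrite psi_aB // psiu psiv subr0.
Qed.

Lemma supported_solutions0 : UA 0.
Proof.
split=> //; apply/funext => n.
rewrite (psi_aE _ p_gt1 _ _ (leqnn _)) big1 // => i _.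
by case: ifP => // _; rewrite [X in iter _ _ X]/0 rmorph0 mulr0.
Qed.

Lemma supported_solutionsD u v : UA u -> UA v -> UA (u + v).
Proof.
by move=> uU vU; rewrite -[v]opprK -[- v]sub0r;
  do 2![apply: supported_solutionsB => //]; exact: supported_solutions0.
Qed.

Lemma supported_solutions_sum (v : int -> int -> R) :
  (forall kappa, KA kappa -> UA (v kappa)) ->
  UA (\sum_(kappa \in KA) v kappa).
Proof.
move=> vU; rewrite fsbig_finite; last exact: finite_KA.
rewrite big_seq; elim/big_ind: _ => [|u w|kappa].
- exact: supported_solutions0.
- exact: supported_solutionsD.
- by rewrite in_fset_set ?inE; [exact: vU | exact: finite_KA].
Qed.

(** The difference vanishes at every characteristic integer, inside [A] by assumption and outside
    [A] by its support, hence everywhere. *)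
Lemma supported_solutions_eq u v : UA u -> UA v ->
  (forall kappa, KA kappa -> u kappa = v kappa) -> u = v.
Proof.
move=> uU vU uv; apply/funext => n; apply/eqP; rewrite -subr_eq0; apply/eqP.
have [uvA psi_uv] := supported_solutionsB uU vU.
have [nA|/uvA //] := pselect (A n).
apply: (psi_a_eq0_char_ints p_gt1 psi_uv) (A_neq0 nA) => kappa kappaK.
have [kappaA|/uvA //] := pselect (A kappa).
by rewrite /GRing.add /= /GRing.opp /= uv // subrr.
Qed.

Lemma supported_solutions_basic_series kappa alpha :
  KA kappa -> UA (u_ kappa alpha).
Proof.
move=> [kappaK kappaA]; split; last exact: psi_a_basic_series.
by move=> n nA; apply: basic_series_out => m nE; apply: nA;
  rewrite nE; exact: A_expp.
Qed.

Lemma fsbig_KA_pred1 (V : nmodType) (c : int -> V) kappa : KA kappa ->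
  \sum_(i \in KA) (if kappa == i then c i else 0) = c kappa.
Proof.
move=> kappaK; rewrite (fsbigD1 kappa) //=; last exact: finite_KA.
by rewrite eqxx fsbig1 ?addr0 // => i [_ /eqP]; rewrite eq_sym => /negPf->.
Qed.

(** Evaluation at [kappa] serves as a coordinate function, since the other basic series vanish
    there. *)
Lemma sum_basic_series_char_ints c kappa : KA kappa ->
  (\sum_(i \in KA) u_ i (c i)) kappa = c kappa.
Proof.
move=> kappaK; rewrite -[RHS]fsbig_KA_pred1 //.
rewrite !fsbig_finite; try exact: finite_KA.
rewrite fct_sumE big_seq [RHS]big_seq; apply: eq_bigr => i.
rewrite in_fset_set ?inE; last exact: finite_KA.
by move=> [iK _]; case: kappaK => kappaK _; rewrite basic_series_char_ints.
Qed.

Lemma supported_solution_sum_basic_series u :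
  UA u -> u = \sum_(kappa \in KA) u_ kappa (u kappa).
Proof.
move=> uU; apply: supported_solutions_eq => // [|kappa kappaK].
  by apply: supported_solutions_sum => kappa /supported_solutions_basic_series.
by rewrite sum_basic_series_char_ints.
Qed.

Lemma basic_series0 kappa : K kappa -> u_ kappa 0 = 0.
Proof.
by move=> /char_ints_neq0 kappa0;
  rewrite -[X in u_ _ X](subrr 0) basic_seriesB // subrr.
Qed.

(** A solution is the sum of the basic series with parameters its values on [KA]; evaluation at each
    [kappa] gives independence. *)
Lemma supported_solutions_direct_sum :
  internal_direct_sum KA (fun kappa => range (u_ kappa)) UA.
Proof.
split=> [kappa [kappaK _]||v vK _ v0 kappa kappaK].
- split=> [|_ _ [alpha _ <-] [beta _ <-]].
    by exists 0; rewrite // basic_series0.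
  by exists (alpha - beta); rewrite // basic_seriesB // char_ints_neq0.
- apply/seteqP; split=> [u uU|u [v [vK _ ->]]].
    exists (fun kappa => u_ kappa (u kappa)); split.
    + by move=> kappa _; exists (u kappa).
    + exact: finite_KA_sub.
    + exact: supported_solution_sum_basic_series.
  by apply: supported_solutions_sum => kappa kappaK;
    have [alpha _ <-] := vK _ kappaK; exact: supported_solutions_basic_series.
have vE i : KA i -> v i = u_ i (v i i).
  move=> iK; have [alpha _ <-] := vK _ iK.
  by rewrite basic_series_char_ints ?eqxx //; case: iK.
rewrite vE //; suff -> : v kappa kappa = 0.
  by rewrite basic_series0 //; case: kappaK.
rewrite -[LHS](sum_basic_series_char_ints (fun i => v i i)) //.
have -> : \sum_(i \in KA) u_ i (v i i) = \sum_(i \in KA) v i.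
  by apply: eq_fsbigr => i; rewrite inE => /vE.
by rewrite v0.
Qed.

(** The module is the space of row vectors indexed by an enumeration [kap] of the finite set [KA].
    The map [iota] takes the coordinates as parameters of basic series, and evaluation at the
    [kap j] inverts it. *)
Lemma supported_solutions_free : (p != 2)%N -> is_frobenius_lift p phi ->
  free_under_convolution p phi mu KA UA.
Proof.
move=> p_neq2 phi_lift; pose s : seq int := fset_set KA.
pose kap (i : 'I_(size s)) := tnth (in_tuple s) i.
have kapK i : KA (kap i).
  have := mem_tnth i (in_tuple s); rewrite in_fset_set ?inE //; exact: finite_KA.
have kap_inj : injective kap by apply/tuple_uniqP; exact: fset_uniq.
have kap_surj kappa : KA kappa -> exists i, kappa = kap i.
  move=> kappaK; apply/tnthP; rewrite in_fset_set ?inE //; exact: finite_KA.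
pose iota (v : 'rV[R]_(size s)) : int -> R := \sum_i u_ (kap i) (v 0 i).
have iotaB : zmod_morphism iota.
  move=> v w; rewrite /iota -sumrB; apply: eq_bigr => i _.
  by rewrite !mxE basic_seriesB // char_ints_neq0 //; case: (kapK i).
have iotaE (v : 'rV[R]_(size s)) j : iota v (kap j) = v 0 j.
  rewrite /iota fct_sumE (bigD1 j) //= big1 ?addr0 => [|i ij].
    by rewrite basic_series_char_ints ?eqxx //; case: (kapK j).
  rewrite basic_series_char_ints ?ifN //; first 1 last.
  - by case: (kapK i).
  - by case: (kapK j).
  - by rewrite (inj_eq kap_inj) eq_sym.
have iotaU (v : 'rV[R]_(size s)) : UA (iota v).
  by rewrite /iota; elim/big_ind: _ => [|u w|i _];
    [exact: supported_solutions0 | exact: supported_solutionsD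
    | exact: supported_solutions_basic_series].
have iota_eq (v : 'rV[R]_(size s)) u :
    UA u -> (forall j, u (kap j) = v 0 j) -> iota v = u.
  by move=> uU uE; apply: supported_solutions_eq => // _ /kap_surj[j ->];
    rewrite iotaE uE.
have iota_scale kappa alpha beta (v : 'rV[R]_(size s)) :
    KA kappa -> iota v = u_ kappa alpha ->
    iota (beta *: v) = u_ kappa (beta * alpha).
  move=> kappaK vE; apply: iota_eq => [|j];
    first exact: supported_solutions_basic_series.
  rewrite mxE -iotaE vE !basic_series_char_ints; try by case: (kapK j).
  - by case: ifP; rewrite ?mulr0.
  - by case: kappaK.
  - by case: kappaK.
pose iotaA : {additive 'rV[R]_(size s) -> (int -> R)} :=
  HB.pack iota (GRing.isZmodMorphism.Build _ _ iota iotaB).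
pose e kappa : 'rV[R]_(size s) := \row_i (if kap i == kappa then 1 else 0).
have sum_eE c j : (\sum_(kappa \in KA) c kappa *: e kappa) 0 j = c (kap j).
  rewrite -[RHS](fsbig_KA_pred1 c (kapK j)).
  rewrite !fsbig_finite; try exact: finite_KA.
  rewrite summxE; apply: eq_bigr => kappa _; rewrite !mxE.
  by case: ifP; rewrite ?mulr1 ?mulr0.
exists 'rV[R]_(size s), iotaA; split; [split | exists e; split; [|split]].
- by move=> v w /= vw; apply/rowP => j; rewrite -!iotaE vw.
- apply/seteqP; split=> [_ [v _ <-] //|u uU].
  by exists (\row_j u (kap j)) => //; apply: (iota_eq _ _ uU) => j; rewrite mxE.
- move=> kappa alpha v kappaK /= vE; split=> [f fG|beta]; last exact: iota_scale.
  rewrite convolution_basic_series //; first exact: iota_scale.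
  by case: kappaK.
- move=> kappa kappaK; apply: iota_eq => [|j];
    first exact: supported_solutions_basic_series.
  by rewrite mxE basic_series_char_ints //; [case: kappaK | case: (kapK j)].
(* The series [iota v] is itself the coefficient function: its value at [kap j] is the coordinate
   [v 0 j]. *)
- move=> v; exists (iota v); split; first exact: finite_KA_sub.
  by apply/rowP => j; rewrite sum_eE iotaE.
- by move=> c _ c0 _ /kap_surj[j ->]; rewrite -sum_eE c0 mxE.
Qed.

End SupportedSolutions.

End Solutions.

(** * Splitting a solution by the sign of its indices *)

Lemma laurent_Rq (p : nat) (R : idomainType) (u : int -> R) :
  Rq u -> laurent_q p u.
Proof.
by move=> uE N; exists (- 1) => n n_lt0;
  rewrite uE ?(le_lt_trans n_lt0) //; exact: pdvd0.
Qed.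

Lemma laurent_RqV (p : nat) (R : idomainType) (u : int -> R) :
  RqV u -> laurent_qV p u.
Proof.
by move=> uE N; exists 1 => n n_gt0;
  rewrite uE ?(lt_le_trans _ n_gt0) //; exact: pdvd0.
Qed.

Section Splitting.
Variables (p : nat) (R : idomainType) (phi : {rmorphism R -> R}).
Variable mu : {poly {poly R}}.
Hypothesis p_gt1 : (1 < p)%N.
Implicit Types u v : int -> R.

Lemma psi_aD u v : psi_a p phi mu (u + v) = psi_a p phi mu u + psi_a p phi mu v.
Proof. by rewrite -[u in RHS](addrK v) psi_aB // subrK. Qed.

(** Multiplication by [p ^ i] preserves signs, so cutting [u] into its parts at [n >= 0] and at
    [n < 0] commutes with [psi_a]. *)
Lemma solution_split u : psi_a p phi mu u = 0 ->
  exists v w, [/\ U_plus p phi mu v, U_minus p phi mu w & u = v + w].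
Proof.
move=> psiu.
have p_gt0 i : (0 < (p ^ i)%N%:Z)%R by rewrite ltz_nat expn_gt0 ltnW.
exists (fun n => if 0 <= n then u n else 0),
  (fun n => if n < 0 then u n else 0).
split.
- split=> [n|]; first by rewrite ltNge; case: ifP.
  rewrite (psi_a_restrict _ _ p_gt1) => [|n i]; last by rewrite pmulr_lge0.
  by rewrite psiu; apply/funext => n; rewrite if_same.
- split=> [n|]; first by move=> n_gt0; rewrite ltNge ltW.
  rewrite (psi_a_restrict _ _ p_gt1) => [|n i]; last by rewrite pmulr_llt0.
  by rewrite psiu; apply/funext => n; rewrite if_same.
- apply/funext => n; rewrite /GRing.add /= ltNge.
  by case: ifP; rewrite ?addr0 ?add0r.
Qed.

Lemma U_plusD u v :
  U_plus p phi mu u -> U_plus p phi mu v -> U_plus p phi mu (u + v).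
Proof.
move=> [uE psiu] [vE psiv]; split=> [n n_lt0|].
  by rewrite /GRing.add /= uE // vE // addr0.
by rewrite psi_aD psiu psiv addr0.
Qed.

Lemma U_minusD u v :
  U_minus p phi mu u -> U_minus p phi mu v -> U_minus p phi mu (u + v).
Proof.
move=> [uE psiu] [vE psiv]; split=> [n n_gt0|].
  by rewrite /GRing.add /= uE // vE // addr0.
by rewrite psi_aD psiu psiv addr0.
Qed.

(** Without characteristic integers every coefficient at a nonzero index is forced to vanish; [A]
    will be either ring of Laurent series. *)
Lemma solutions_char_ints0 (A : set (int -> R)) : char_ints mu = set0 ->
  constant_series (R := R) `<=` A -> solutions p phi mu A = U_0 p phi mu.
Proof.
move=> K0 constA; apply/seteqP; split=> u [uA psiu]; split=> //;
  last exact: constA.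
by move=> n; apply: (psi_a_eq0_char_ints p_gt1 psiu) => kappa; rewrite K0.
Qed.

End Splitting.

(** * The three assertions on the groups of solutions of [psi_a] *)

Theorem theorem6p10 (p : nat) (R : idomainType) (phi : {rmorphism R -> R})
    (mu : {poly {poly R}}) :
  prime p -> (p != 2)%N ->
  is_completed_max_unramified p R -> is_frobenius_lift p phi ->
  nondegenerate_char mu ->
  [/\ char_ints mu = set0 ->
        U_left p phi mu = U_right p phi mu /\ U_right p phi mu = U_0 p phi mu,
      (internal_direct_sum (char_ints_pos mu)
         (fun kappa => range (basic_series p phi mu kappa)) (U_1 p phi mu) /\
       internal_direct_sum (char_ints_neg mu)
         (fun kappa => range (basic_series p phi mu kappa)) (U_m1 p phi mu)) /\
      (free_under_convolution p phi mu (char_ints_pos mu) (U_1 p phi mu) /\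
       free_under_convolution p phi mu (char_ints_neg mu) (U_m1 p phi mu))
    & [set u + v | u in U_right p phi mu & v in U_left p phi mu] =
      [set u + v | u in U_plus p phi mu & v in U_minus p phi mu]].
Proof.
move=> p_prime p_neq2 Rcmu phi_lift mu_nondeg; have p_gt1 := prime_gt1 p_prime.
have p_gt0 i : (0 < (p ^ i)%N%:Z)%R by rewrite ltz_nat expn_gt0 ltnW.
split=> [K0||].
- have U_leftE : U_left p phi mu = U_0 p phi mu.
    apply: solutions_char_ints0 => // u uE; apply: laurent_RqV => n n_gt0.
    by rewrite uE // gt_eqF.
  have U_rightE : U_right p phi mu = U_0 p phi mu.
    apply: solutions_char_ints0 => // u uE; apply: laurent_Rq => n n_lt0.
    by rewrite uE // lt_eqF.
  by rewrite U_leftE U_rightE.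
(* The support conditions are restated as vanishing off [0 < n] and off [n < 0], the form used for a
   general [A]. *)
- have -> : U_1 p phi mu =
      solutions p phi mu [set u | forall n, ~ (0 < n) -> u n = 0].
    congr solutions; apply/seteqP; split=> u uE n.
      by move=> /negP; rewrite -leNgt; exact: uE.
    by move=> n_le0; apply: uE; apply/negP; rewrite -leNgt.
  have -> : U_m1 p phi mu =
      solutions p phi mu [set u | forall n, ~ (n < 0) -> u n = 0].
    congr solutions; apply/seteqP; split=> u uE n.
      by move=> /negP; rewrite -leNgt; exact: uE.
    by move=> n_ge0; apply: uE; apply/negP; rewrite -leNgt.
  have pos_neq0 (n : int) : 0 < n -> n != 0 by move=> /gt_eqF->.
  have neg_neq0 (n : int) : n < 0 -> n != 0 by move=> /lt_eqF->.
  have pos_expp (n : int) m : 0 < n -> 0 < n * (p ^ m)%N%:Z.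
    by move=> n_gt0; rewrite mulr_gt0.
  have neg_expp (n : int) m : n < 0 -> n * (p ^ m)%N%:Z < 0.
    by move=> n_lt0; rewrite pmulr_llt0.
  split; split.
  + exact: (supported_solutions_direct_sum phi p_prime Rcmu mu_nondeg
      pos_neq0 pos_expp).
  + exact: (supported_solutions_direct_sum phi p_prime Rcmu mu_nondeg
      neg_neq0 neg_expp).
  + exact: (supported_solutions_free p_prime Rcmu mu_nondeg
      pos_neq0 pos_expp p_neq2 phi_lift).
  + exact: (supported_solutions_free p_prime Rcmu mu_nondeg
      neg_neq0 neg_expp p_neq2 phi_lift).
(* Both summands are split by sign and the four pieces regrouped; conversely, power series are
   Laurent series. *)
apply/seteqP; split=> _ [u [uA psiu] [v [vA psiv] <-]].
  have [u1 [u2 [u1U u2U ->]]] := solution_split p_gt1 psiu.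
  have [v1 [v2 [v1U v2U ->]]] := solution_split p_gt1 psiv.
  exists (u1 + v1); first exact: U_plusD.
  by exists (u2 + v2); [exact: U_minusD | rewrite addrACA].
exists u; first by split=> //; exact: laurent_Rq.
by exists v => //; split=> //; exact: laurent_RqV.
Qed.
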